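(* There exist a differentiable manifold $M$, a real smooth vector bundle $\xi$ over $M$, and a pseudoconnection $\nabla$ of $\xi$ with some principal homomorphism $P$, such that $$F^\nabla=P\circ d^\nabla\circ\nabla-d^\nabla\circ P\circ\nabla+d^\nabla\circ\nabla\circ P:\Omega^0(\xi)\to\Omega^2(\xi)$$ is identically zero, but the exterior derivative $d^\nabla$ of $\nabla$ is not a chain complex, i.e. it is not the case that $d^\nabla\circ d^\nabla=0$ on $\Omega^k(\xi)$ for all $k\ge0$.
   Context: $\Omega^0(M)$ is the ring of $C^\infty$ real-valued functions on $M$, $\Omega^k(M)$ the $\Omega^0(M)$-module of smooth $k$-forms, $d$ the standard exterior derivative. For a real smooth vector bundle $\xi$ over $M$, $\Omega^0(\xi)$ is the $\Omega^0(M)$-module of smooth sections of $\xi$, and $\Omega^k(\xi)=\Omega^k(M)\otimes_{\Omega^0(M)}\Omega^0(\xi)$ for $k\ge 1$. $HOM(\xi,\xi)$ is the set of bundle homomorphisms $\xi\to\xi$ over the identity of $M$; each $P\in HOM(\xi,\xi)$ acts on sections and on $\Omega^k(\xi)$ by $P(\omega\otimes s)=\omega\otimes P(s)$. The product $\wedge:\Omega^k(M)\times\Omega^l(\xi)\to\Omega^{k+l}(\xi)$ is given on generators by $\beta\wedge(\omega\otimes s)=(\beta\wedge\omega)\otimes s$. A pseudoconnection of $\xi$ with principal homomorphism $P\in HOM(\xi,\xi)$ is an $\mathbb{R}$-linear map $\nabla:\Omega^0(\xi)\to\Omega^1(\xi)$ such that $\nabla(f\cdot s)=df\otimes P(s)+f\cdot\nabla(s)$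 for all $f\in\Omega^0(M)$, $s\in\Omega^0(\xi)$. Its exterior derivative is the sequence of $\mathbb{R}$-linear maps $d^\nabla:\Omega^k(\xi)\to\Omega^{k+1}(\xi)$, $k\ge0$, with $d^\nabla=\nabla$ for $k=0$, determined on generators by $d^\nabla(\omega\otimes s)=d\omega\otimes P(s)+(-1)^k\omega\wedge\nabla s$ for $\omega\in\Omega^k(M)$, $s\in\Omega^0(\xi)$. *)

(* Defs.v *)
From HB Require Import structures.
From mathcomp Require Import all_boot all_order all_algebra all_fingroup.
From mathcomp Require Import ring.
From mathcomp Require Import boolp classical_sets functions reals.
From mathcomp Require Import topology normedtype derive.
Set Implicit Arguments. Unset Strict Implicit. Unset Printing Implicit Defensive.
Import Order.TTheory GRing.Theory Num.Theory.
Import numFieldNormedType.Exports.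
Local Open Scope classical_set_scope.
Local Open Scope ring_scope.

Lemma eq_open_continuous (T U : topologicalType) (O : set T) (f g : T -> U) x :
  open O -> (forall y, O y -> f y = g y) -> O x ->
  {for x, continuous f} -> {for x, continuous g}.
Proof.
move=> oO fg Ox cf; rewrite /prop_for /continuous_at -(fg x Ox).
apply: cvg_trans cf; apply: near_eq_cvg.
apply: filterS (open_nbhs_nbhs (conj oO Ox)) => y; exact: fg.
Qed.

Section Euclid.
Context {R : realType} {n : nat}.
Implicit Types (O : set 'rV[R]_n) (f g : 'rV[R]_n -> R).

Fixpoint Ck (k : nat) O f : Prop :=
  (forall x, O x -> {for x, continuous f}) /\
  (if k is k'.+1 then
     forall i : 'I_n, (forall x, O x -> derivable f x (delta_mx 0 i)) /\
                      Ck k' O ('D_(delta_mx 0 i) f)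
   else True).

Definition smooth O f := forall k, Ck k O f.

Lemma Ck_cont k O f : Ck k O f -> forall x, O x -> {for x, continuous f}.
Proof. by case: k => [|k] []. Qed.

Lemma CkW k O f : Ck k.+1 O f -> Ck k O f.
Proof.
elim: k f => [|k IH] f [cf df]; first by split.
by split=> // i; have [d1 d2] := df i; split=> //; apply: IH.
Qed.

Lemma eq_Ck k O f g : open O -> (forall x, O x -> f x = g x) ->
  Ck k O f -> Ck k O g.
Proof.
move=> oO; elim: k f g => [|k IH] f g fg [cf df].
  by split=> // x Ox; exact: eq_open_continuous oO fg Ox (cf x Ox).
split; first by move=> x Ox; exact: eq_open_continuous oO fg Ox (cf x Ox).
move=> i; have [d1 d2] := df i; split.
  move=> x Ox; apply: near_eq_derivable (d1 _ Ox).
  by apply: filterS (open_nbhs_nbhs (conj oO Ox)) => y Oy; exact: fg.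
apply: IH d2 => x Ox; apply: near_eq_derive.
by apply: filterS (open_nbhs_nbhs (conj oO Ox)) => y Oy; exact: fg.
Qed.

Lemma Ck_cst k O (c : R) : Ck k O (fun=> c).
Proof.
elim: k c => [|k IH] c; first by split=> // x _; exact: cst_continuous.
split; first by move=> x _; exact: cst_continuous.
move=> i; split; first by move=> x _; exact: derivable_cst.
have -> : 'D_(delta_mx 0 i) (fun=> c) = (fun=> 0) :> ('rV[R]_n -> R).
  by apply/funext => x; exact: (derive_cst c).
exact: IH.
Qed.

Lemma CkD k O f g : open O -> Ck k O f -> Ck k O g ->
  Ck k O (fun x => f x + g x).
Proof.
move=> oO; elim: k f g => [|k IH] f g [cf df] [cg dg].
  by split=> // x Ox; apply: continuousD; [exact: cf|exact: cg].
split; first by move=> x Ox; apply: continuousD; [exact: cf|exact: cg].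
move=> i; have [d1 d2] := df i; have [e1 e2] := dg i; split.
  by move=> x Ox; apply: derivableD; [exact: d1|exact: e1].
apply: eq_Ck (IH _ _ d2 e2) => // x Ox.
by rewrite deriveD//; [exact: d1|exact: e1].
Qed.

Lemma CkM k O f g : open O -> Ck k O f -> Ck k O g ->
  Ck k O (fun x => f x * g x).
Proof.
move=> oO; elim: k f g => [|k IH] f g Cf Cg.
  case: Cf Cg => [cf _] [cg _].
  by split=> // x Ox; apply: continuousM; [exact: cf|exact: cg].
case: (Cf) (Cg) => [cf df] [cg dg].
split; first by move=> x Ox; apply: continuousM; [exact: cf|exact: cg].
move=> i; have [d1 d2] := df i; have [e1 e2] := dg i; split.
  by move=> x Ox; apply: derivableM; [exact: d1|exact: e1].
apply: eq_Ck (CkD oO (IH _ _ (CkW Cf) e2) (IH _ _ (CkW Cg) d2)) => // x Ox.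
by rewrite deriveM//; [exact: d1|exact: e1].
Qed.

Lemma smooth_eq O f g : open O -> (forall x, O x -> f x = g x) ->
  smooth O f -> smooth O g.
Proof. by move=> oO fg sf k; exact: eq_Ck (sf k). Qed.

Lemma smooth_cst O (c : R) : smooth O (fun=> c).
Proof. by move=> k; exact: Ck_cst. Qed.

Lemma smoothD O f g : open O -> smooth O f -> smooth O g ->
  smooth O (fun x => f x + g x).
Proof. by move=> oO sf sg k; exact: CkD. Qed.

Lemma smoothM O f g : open O -> smooth O f -> smooth O g ->
  smooth O (fun x => f x * g x).
Proof. by move=> oO sf sg k; exact: CkM. Qed.

End Euclid.

Record chart (R : realType) (n : nat) (M : topologicalType) := Chart {
  cdom : set M;
  cimg : set 'rV[R]_n;
  cmap : M -> 'rV[R]_n;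
  cinv : 'rV[R]_n -> M;
  cdom_open : open cdom;
  cimg_open : open cimg;
  cmap_img : forall p, cdom p -> cimg (cmap p);
  cinv_dom : forall x, cimg x -> cdom (cinv x);
  cmapK : forall p, cdom p -> cinv (cmap p) = p;
  cinvK : forall x, cimg x -> cmap (cinv x) = x;
  cmap_cont : forall p, cdom p -> {for p, continuous cmap};
  cinv_cont : forall x, cimg x -> {for x, continuous cinv}
}.

Record manifold (R : realType) := Manifold {
  mtop :> topologicalType;
  mdim : nat;
  mindex : Type;
  mchart : mindex -> chart R mdim mtop;
  mhausdorff : hausdorff_space mtop;
  mcountable : @second_countable mtop;
  mcover : forall p : mtop, exists i, cdom (mchart i) p;
  mtransition : forall i j (c : 'I_mdim),
    smooth (cimg (mchart i) `&` cinv (mchart i) @^-1` cdom (mchart j))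
           (fun x => cmap (mchart j) (cinv (mchart i) x) 0 c)
}.

Section SmoothOn.
Context {R : realType} {M : manifold R}.
Implicit Types (W : set M) (f g : M -> R).

(* Meant for open W. *)
Definition smooth_on W f := forall i : mindex M,
  smooth (cimg (mchart i) `&` cinv (mchart i) @^-1` W) (f \o cinv (mchart i)).

Lemma chart_open W (i : mindex M) : open W ->
  open (cimg (mchart i) `&` cinv (mchart i) @^-1` W).
Proof.
move=> oW; rewrite openE => x [Ix Wx]; apply: filterI.
  by apply: open_nbhs_nbhs; split=> //; exact: cimg_open.
by apply: (cinv_cont Ix); apply: open_nbhs_nbhs.
Qed.

Lemma smooth_on_eq W f g : open W -> (forall x, W x -> f x = g x) ->
  smooth_on W f -> smooth_on W g.
Proof.
move=> oW fg sf i; apply: smooth_eq (sf i); first exact: chart_open.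
by move=> x [_ Wx] /=; rewrite fg.
Qed.

Lemma smooth_on_cst W (c : R) : smooth_on W (fun=> c).
Proof. by move=> i; exact: smooth_cst. Qed.

Lemma smooth_onD W f g : open W -> smooth_on W f -> smooth_on W g ->
  smooth_on W (fun x => f x + g x).
Proof. by move=> oW sf sg i; apply: smoothD; [exact: chart_open| |]. Qed.

Lemma smooth_onM W f g : open W -> smooth_on W f -> smooth_on W g ->
  smooth_on W (fun x => f x * g x).
Proof. by move=> oW sf sg i; apply: smoothM; [exact: chart_open| |]. Qed.

Lemma smooth_onN W f : open W -> smooth_on W f -> smooth_on W (fun x => - f x).
Proof.
move=> oW sf; apply: smooth_on_eq (smooth_onM oW (smooth_on_cst W (-1)) sf) => //.
by move=> x _; rewrite mulN1r.
Qed.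

Lemma smooth_on_sum (I : finType) W (F : I -> M -> R) : open W ->
  (forall i, smooth_on W (F i)) -> smooth_on W (fun x => \sum_i F i x).
Proof.
move=> oW sF; rewrite -[index_enum I]/(index_enum I).
elim: (index_enum I) => [|i s IH].
  by apply: smooth_on_eq (smooth_on_cst W 0) => // x _; rewrite big_nil.
by apply: smooth_on_eq (smooth_onD oW (sF i) IH) => // x _; rewrite big_cons.
Qed.

Lemma sub_Ck n k (O O' : set 'rV[R]_n) h : O' `<=` O -> Ck k O h -> Ck k O' h.
Proof.
move=> OO; elim: k h => [|k IH] h [ch dh]; first by split=> // x /OO/ch.
split; first by move=> x /OO/ch.
by move=> i; have [d1 d2] := dh i; split; [move=> x /OO/d1|exact: IH].
Qed.

Lemma sub_smooth_on W W' f : W' `<=` W -> smooth_on W f -> smooth_on W' f.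
Proof.
move=> WW sf i k; apply: sub_Ck (sf i k) => x [Ix Wx]; split=> //.
exact: WW.
Qed.

End SmoothOn.

Record Cinf (R : realType) (M : manifold R) := MkCinf {
  Cfun :> M -> R;
  Cfun_smooth : smooth_on setT Cfun
}.

Section CinfRing.
Context {R : realType} {M : manifold R}.
Implicit Types f g h : Cinf M.

Lemma Cinf_ext f g : (forall p, f p = g p) -> f = g.
Proof.
case: f g => [f sf] [g sg] /= /funext fg; rewrite fg in sf *.
by congr MkCinf; exact: Prop_irrelevance.
Qed.

HB.instance Definition _ := gen_eqMixin (Cinf M).
HB.instance Definition _ := gen_choiceMixin (Cinf M).

Definition Cinf_cst (c : R) : Cinf M := MkCinf (smooth_on_cst setT c).
Definition Cinf_add f g := MkCinf
  (smooth_onD openT (Cfun_smooth f) (Cfun_smooth g)).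
Definition Cinf_opp f := MkCinf (smooth_onN openT (Cfun_smooth f)).
Definition Cinf_mul f g := MkCinf
  (smooth_onM openT (Cfun_smooth f) (Cfun_smooth g)).

Fact Cinf_addA : associative Cinf_add.
Proof. by move=> f g h; apply: Cinf_ext => p; exact: addrA. Qed.
Fact Cinf_addC : commutative Cinf_add.
Proof. by move=> f g; apply: Cinf_ext => p; exact: addrC. Qed.
Fact Cinf_add0 : left_id (Cinf_cst 0) Cinf_add.
Proof. by move=> f; apply: Cinf_ext => p; exact: add0r. Qed.
Fact Cinf_addN : left_inverse (Cinf_cst 0) Cinf_opp Cinf_add.
Proof. by move=> f; apply: Cinf_ext => p; exact: addNr. Qed.
Fact Cinf_mulA : associative Cinf_mul.
Proof. by move=> f g h; apply: Cinf_ext => p; exact: mulrA. Qed.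
Fact Cinf_mulC : commutative Cinf_mul.
Proof. by move=> f g; apply: Cinf_ext => p; exact: mulrC. Qed.
Fact Cinf_mul1 : left_id (Cinf_cst 1) Cinf_mul.
Proof. by move=> f; apply: Cinf_ext => p; exact: mul1r. Qed.
Fact Cinf_mulD : left_distributive Cinf_mul Cinf_add.
Proof. by move=> f g h; apply: Cinf_ext => p; exact: mulrDl. Qed.

HB.instance Definition _ := GRing.isZmodule.Build (Cinf M)
  Cinf_addA Cinf_addC Cinf_add0 Cinf_addN.
HB.instance Definition _ := GRing.Zmodule_isComPzRing.Build (Cinf M)
  Cinf_mulA Cinf_mulC Cinf_mul1 Cinf_mulD.

Lemma Cinf0E p : (0 : Cinf M) p = 0. Proof. by []. Qed.
Lemma Cinf1E p : (1 : Cinf M) p = 1. Proof. by []. Qed.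
Lemma CinfDE f g p : (f + g) p = f p + g p. Proof. by []. Qed.
Lemma CinfNE f p : (- f) p = - f p. Proof. by []. Qed.
Lemma CinfME f g p : (f * g) p = f p * g p. Proof. by []. Qed.

Lemma Cinf_halve f : f + f = 0 -> f = 0.
Proof.
move=> ff; apply: Cinf_ext => p; have /eqP := congr1 (fun h => Cfun h p) ff.
by rewrite CinfDE -mulr2n mulrn_eq0 /= => /eqP.
Qed.

End CinfRing.

(* A bundle of rank r is given by its fibres and a family of local
   trivializations E|_U ~ U x R^r, linear on fibres, whose transition functions
   U `&` V -> GL_r(R) are smooth; this determines the smooth structure of the
   total space.  Coordinates are row vectors, so matrices act on the right.
   The trivialization [vtriv j p] is only meaningful for p in [vdom j]. *)
Record vbundle (R : realType) (M : manifold R) := VBundle {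
  fib : M -> lmodType R;
  vrank : nat;
  vindex : Type;
  vdom : vindex -> set M;
  vtriv : forall (j : vindex) (p : M), {linear fib p -> 'rV[R]_vrank};
  vdom_open : forall j, open (vdom j);
  vcover : forall p, exists j, vdom j p;
  vtriv_bij : forall j p, vdom j p -> bijective (vtriv j p);
  vtransition : forall i j, exists g : M -> 'M[R]_vrank,
    (forall a b, smooth_on (vdom i `&` vdom j) (fun p => g p a b)) /\
    (forall p v, (vdom i `&` vdom j) p -> vtriv j p v = vtriv i p v *m g p)
}.

(* The c-th coordinate of s in the j-th trivialization; used only on [vdom j]. *)
Definition vcoord (R : realType) (M : manifold R) (xi : vbundle M)
  (s : forall p : M, fib xi p) (j : vindex xi) (c : 'I_(vrank xi)) : M -> R :=
  fun p => vtriv j p (s p) 0 c.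

Record section (R : realType) (M : manifold R) (xi : vbundle M) := MkSection {
  sfun :> forall p : M, fib xi p;
  sfun_smooth : forall j c, smooth_on (vdom j) (vcoord sfun j c)
}.

(* Bundle homomorphisms xi -> xi over the identity of M. *)
Record bhom (R : realType) (M : manifold R) (xi : vbundle M) := MkBHom {
  bfun : forall p : M, {linear fib xi p -> fib xi p};
  bfun_smooth : forall j : vindex xi, exists g : M -> 'M[R]_(vrank xi),
    (forall a b, smooth_on (vdom j) (fun p => g p a b)) /\
    (forall p v, vdom j p -> vtriv j p (bfun p v) = vtriv j p v *m g p)
}.

Section SectionModule.
Context {R : realType} {M : manifold R} {xi : vbundle M}.
Implicit Types s t : section xi.

Lemma section_ext s t : (forall p, s p = t p) -> s = t.
Proof.
case: s t => [s ss] [t st] /= e.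
have E : s = t by exact: functional_extensionality_dep.
subst t.
by congr MkSection; exact: Prop_irrelevance.
Qed.

HB.instance Definition _ := gen_eqMixin (section xi).
HB.instance Definition _ := gen_choiceMixin (section xi).

Fact section_zero_smooth j c :
  smooth_on (vdom j) (@vcoord R M xi (fun=> 0) j c).
Proof.
apply: (@smooth_on_eq _ _ (vdom j) (fun=> 0)); first exact: vdom_open.
  by move=> p _; rewrite /vcoord linear0 mxE.
exact: smooth_on_cst.
Qed.
Fact section_add_smooth s t j c :
  smooth_on (vdom j) (@vcoord R M xi (fun p => s p + t p) j c).
Proof.
have o := vdom_open j.
apply: smooth_on_eq (smooth_onD o (sfun_smooth s j c) (sfun_smooth t j c)) => // p _.
by rewrite /vcoord linearD mxE.
Qed.
Fact section_scale_smooth (f : Cinf M) s j c :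
  smooth_on (vdom j) (@vcoord R M xi (fun p => f p *: s p) j c).
Proof.
have o := vdom_open j.
apply: smooth_on_eq (smooth_onM o (sub_smooth_on (@subsetT _ _) (Cfun_smooth f))
  (sfun_smooth s j c)) => // p _.
by rewrite /vcoord linearZ mxE.
Qed.
Fact section_opp_smooth s j c :
  smooth_on (vdom j) (@vcoord R M xi (fun p => - s p) j c).
Proof.
have o := vdom_open j.
apply: smooth_on_eq (smooth_onN o (sfun_smooth s j c)) => // p _.
by rewrite /vcoord linearN mxE.
Qed.

Definition section_zero := MkSection section_zero_smooth.
Definition section_add s t := MkSection (section_add_smooth s t).
Definition section_opp s := MkSection (section_opp_smooth s).
Definition section_scale (f : Cinf M) s := MkSection (section_scale_smooth f s).

Fact section_addA : associative section_add.
Proof. by move=> r s t; apply: section_ext => p; exact: addrA. Qed.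
Fact section_addC : commutative section_add.
Proof. by move=> s t; apply: section_ext => p; exact: addrC. Qed.
Fact section_add0 : left_id section_zero section_add.
Proof. by move=> s; apply: section_ext => p; exact: add0r. Qed.
Fact section_addN : left_inverse section_zero section_opp section_add.
Proof. by move=> s; apply: section_ext => p; exact: addNr. Qed.
HB.instance Definition _ := GRing.isZmodule.Build (section xi)
  section_addA section_addC section_add0 section_addN.

Fact section_scaleA (f g : Cinf M) s :
  section_scale f (section_scale g s) = section_scale (f * g) s.
Proof. by apply: section_ext => p; exact: scalerA. Qed.
Fact section_scale1 : left_id (1 : Cinf M) section_scale.
Proof. by move=> s; apply: section_ext => p; exact: scale1r. Qed.
Fact section_scaleDr : right_distributive section_scale +%R.
Proof. by move=> f s t; apply: section_ext => p; exact: scalerDr. Qed.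
Fact section_scaleDl s : {morph section_scale^~ s : f g / f + g}.
Proof. by move=> f g; apply: section_ext => p; exact: scalerDl. Qed.
HB.instance Definition _ := GRing.Zmodule_isLmodule.Build (Cinf M) (section xi)
  section_scaleA section_scale1 section_scaleDr section_scaleDl.

Fact bhom_section_smooth (P : bhom xi) s j c :
  smooth_on (vdom j) (@vcoord R M xi (fun p => bfun P p (s p)) j c).
Proof.
have [g [sg gE]] := bfun_smooth P j; have o := vdom_open j.
apply: (@smooth_on_eq _ _ _
  (fun p => \sum_a vcoord s j a p * g p a c)) => // [p Wp|].
  by rewrite /vcoord gE// mxE.
by apply: smooth_on_sum => // a; apply: smooth_onM => //; exact: sfun_smooth.
Qed.

Definition bhom_section (P : bhom xi) s : section xi :=
  MkSection (bhom_section_smooth P s).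

Lemma bhom_section_linear P (f : Cinf M) s t :
  bhom_section P (f *: s + t) = f *: bhom_section P s + bhom_section P t.
Proof. by apply: section_ext => p; exact: linearP. Qed.

Lemma bhom_section0 P : bhom_section P 0 = 0.
Proof. by apply: section_ext => p; exact: linear0. Qed.

End SectionModule.


(* Vector fields on M, as the derivations of its ring of smooth functions. *)
Record vfield (R : realType) (M : manifold R) := MkVfield {
  vact :> Cinf M -> Cinf M;
  vact_linear : forall c (f g : Cinf M),
    vact (Cinf_cst c * f + g) = Cinf_cst c * vact f + vact g;
  vact_leibniz : forall f g : Cinf M, vact (f * g) = vact f * g + f * vact g
}.

Section VfieldModule.
Context {R : realType} {M : manifold R}.
Implicit Types (X Y Z : vfield M) (f g h : Cinf M).

Lemma vfield_ext X Y : (forall f, X f = Y f) -> X = Y.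
Proof.
case: X Y => [X X1 X2] [Y Y1 Y2] /= e.
have E : X = Y by exact: funext.
by subst Y; congr MkVfield; exact: Prop_irrelevance.
Qed.

Lemma vactD X f g : X (f + g) = X f + X g.
Proof.
have E : Cinf_cst 1 = 1 :> Cinf M by exact: Cinf_ext.
by have := vact_linear X 1 f g; rewrite !E !mul1r.
Qed.

Lemma vact0 X : X 0 = 0.
Proof. by have := vactD X 0 0; rewrite addr0 -{1}[X 0]addr0 => /addrI. Qed.

Lemma vactN X f : X (- f) = - X f.
Proof. by apply/eqP; rewrite -addr_eq0 -vactD addNr vact0. Qed.

HB.instance Definition _ := gen_eqMixin (vfield M).
HB.instance Definition _ := gen_choiceMixin (vfield M).

Fact vfield_zero_linear c f g :
  (0 : Cinf M) = Cinf_cst c * 0 + 0.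
Proof. by rewrite mulr0 addr0. Qed.
Fact vfield_zero_leibniz f g : (0 : Cinf M) = 0 * g + f * 0.
Proof. by rewrite mulr0 mul0r addr0. Qed.
Definition vfield_zero : vfield M :=
  @MkVfield _ _ (fun=> 0) vfield_zero_linear vfield_zero_leibniz.

Fact vfield_add_linear X Y c f g :
  X (Cinf_cst c * f + g) + Y (Cinf_cst c * f + g) =
  Cinf_cst c * (X f + Y f) + (X g + Y g).
Proof. by rewrite !vact_linear mulrDr addrACA. Qed.
Fact vfield_add_leibniz X Y f g :
  X (f * g) + Y (f * g) = (X f + Y f) * g + f * (X g + Y g).
Proof. by rewrite !vact_leibniz mulrDr mulrDl addrACA. Qed.
Definition vfield_add X Y : vfield M :=
  @MkVfield _ _ (fun f => X f + Y f) (vfield_add_linear X Y)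
    (vfield_add_leibniz X Y).

Fact vfield_scale_linear h X c f g :
  h * X (Cinf_cst c * f + g) = Cinf_cst c * (h * X f) + h * X g.
Proof. by rewrite vact_linear mulrDr mulrCA. Qed.
Fact vfield_scale_leibniz h X f g :
  h * X (f * g) = (h * X f) * g + f * (h * X g).
Proof. by rewrite vact_leibniz mulrDr mulrA [in X in _ + X]mulrCA. Qed.
Definition vfield_scale h X : vfield M :=
  @MkVfield _ _ (fun f => h * X f) (vfield_scale_linear h X)
    (vfield_scale_leibniz h X).

Definition vfield_opp X : vfield M := vfield_scale (-1) X.

Fact vfield_addA : associative vfield_add.
Proof. by move=> X Y Z; apply: vfield_ext => f; exact: addrA. Qed.
Fact vfield_addC : commutative vfield_add.
Proof. by move=> X Y; apply: vfield_ext => f; exact: addrC. Qed.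
Fact vfield_add0 : left_id vfield_zero vfield_add.
Proof. by move=> X; apply: vfield_ext => f; exact: add0r. Qed.
Fact vfield_addN : left_inverse vfield_zero vfield_opp vfield_add.
Proof. by move=> X; apply: vfield_ext => f; rewrite /= mulN1r addNr. Qed.
HB.instance Definition _ := GRing.isZmodule.Build (vfield M)
  vfield_addA vfield_addC vfield_add0 vfield_addN.

Fact vfield_scaleA (f g : Cinf M) X :
  vfield_scale f (vfield_scale g X) = vfield_scale (f * g) X.
Proof. by apply: vfield_ext => h; exact: mulrA. Qed.
Fact vfield_scale1 : left_id (1 : Cinf M) vfield_scale.
Proof. by move=> X; apply: vfield_ext => f; exact: mul1r. Qed.
Fact vfield_scaleDr : right_distributive vfield_scale +%R.
Proof. by move=> f X Y; apply: vfield_ext => h; exact: mulrDr. Qed.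
Fact vfield_scaleDl X : {morph vfield_scale^~ X : f g / f + g}.
Proof. by move=> f g; apply: vfield_ext => h; exact: mulrDl. Qed.
HB.instance Definition _ := GRing.Zmodule_isLmodule.Build (Cinf M) (vfield M)
  vfield_scaleA vfield_scale1 vfield_scaleDr vfield_scaleDl.

Lemma vfieldDE X Y f : (X + Y) f = X f + Y f. Proof. by []. Qed.
Lemma vfieldZE h X f : (h *: X) f = h * X f. Proof. by []. Qed.
Lemma vfield0E f : (0 : vfield M) f = 0. Proof. by []. Qed.
Lemma vfieldNE X f : (- X) f = - X f. Proof. exact: mulN1r. Qed.

Fact bracket_linear X Y c f g :
  X (Y (Cinf_cst c * f + g)) - Y (X (Cinf_cst c * f + g)) =
  Cinf_cst c * (X (Y f) - Y (X f)) + (X (Y g) - Y (X g)).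
Proof. by rewrite !vact_linear mulrBr opprD addrACA. Qed.
Fact bracket_leibniz X Y f g :
  X (Y (f * g)) - Y (X (f * g)) =
  (X (Y f) - Y (X f)) * g + f * (X (Y g) - Y (X g)).
Proof.
by rewrite !vact_leibniz !vactD !vact_leibniz; ring.
Qed.
Definition bracket X Y : vfield M :=
  @MkVfield _ _ (fun f => X (Y f) - Y (X f)) (bracket_linear X Y)
    (bracket_leibniz X Y).

Lemma bracketE X Y f : bracket X Y f = X (Y f) - Y (X f). Proof. by []. Qed.

Lemma bracketC X Y : bracket X Y = - bracket Y X.
Proof. by apply: vfield_ext => f; rewrite vfieldNE !bracketE opprB. Qed.

Lemma bracketr f X Y Z :
  bracket X (f *: Y + Z) = f *: bracket X Y + X f *: Y + bracket X Z.
Proof.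
apply: vfield_ext => h.
by rewrite !(vfieldDE, vfieldZE, bracketE) vactD vact_leibniz; ring.
Qed.

Lemma bracketl f X Y Z :
  bracket (f *: Y + Z) X = f *: bracket Y X - X f *: Y + bracket Z X.
Proof.
apply: vfield_ext => h.
by rewrite !(vfieldDE, vfieldNE, vfieldZE, bracketE) vactD vact_leibniz; ring.
Qed.

End VfieldModule.

Definition upd (n : nat) (T : Type) (X : 'I_n -> T) (i : 'I_n) (Y : T) :=
  fun j => if j == i then Y else X j.

(* Smooth k-forms on M, as the alternating maps from k vector fields to smooth
   functions that are multilinear over the ring of smooth functions. *)
Record form (R : realType) (M : manifold R) (k : nat) := MkForm {
  ffun_of :> ('I_k -> vfield M) -> Cinf M;
  form_linear : forall (X : 'I_k -> vfield M) i (f : Cinf M) (Y Z : vfield M),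
    ffun_of (upd X i (f *: Y + Z)) =
      f * ffun_of (upd X i Y) + ffun_of (upd X i Z);
  form_alt : forall (X : 'I_k -> vfield M) i j,
    i != j -> X i = X j -> ffun_of X = 0
}.

Section Upd.
Context {n : nat} {T : Type}.
Implicit Types (X : 'I_n -> T) (i j : 'I_n).

Lemma upd_eq X i Y : upd X i Y i = Y. Proof. by rewrite /upd eqxx. Qed.
Lemma upd_neq X i Y j : j != i -> upd X i Y j = X j.
Proof. by rewrite /upd => /negbTE->. Qed.
Lemma upd_id X i : upd X i (X i) = X.
Proof. by apply/funext => j; rewrite /upd; case: eqP => // ->. Qed.
Lemma upd_upd X i Y Z : upd (upd X i Y) i Z = upd X i Z.
Proof. by apply/funext => j; rewrite /upd; case: eqP. Qed.
Lemma updC X i j Y Z : i != j -> upd (upd X i Y) j Z = upd (upd X j Z) i Y.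
Proof.
move=> ij; apply/funext => l; rewrite /upd; case: (eqVneq l j) => // ->.
by rewrite eq_sym (negbTE ij).
Qed.
Lemma upd_perm X i Y (s : 'S_n) : upd X i Y \o s = upd (X \o s) ((s^-1)%g i) Y.
Proof. by apply/funext => j; rewrite /upd /= (can2_eq (permK s) (permKV s)). Qed.
End Upd.

Lemma upd_lift_same n T (X : 'I_n.+1 -> T) i Y :
  upd X i Y \o lift i = X \o lift i.
Proof. by apply/funext => j; rewrite /= upd_neq // eq_sym neq_lift. Qed.

Lemma upd_lift n T (X : 'I_n.+1 -> T) i j Y :
  upd X (lift i j) Y \o lift i = upd (X \o lift i) j Y.
Proof. by apply/funext => l; rewrite /upd /= (inj_eq lift_inj). Qed.

Section FormModule.
Context {R : realType} {M : manifold R} {k : nat}.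
Implicit Types (w v : form M k) (X : 'I_k -> vfield M) (f g : Cinf M).

Lemma form_ext w v : (forall X, w X = v X) -> w = v.
Proof.
case: w v => [w w1 w2] [v v1 v2] /= e.
have E : w = v by exact: funext.
by subst v; congr MkForm; exact: Prop_irrelevance.
Qed.

HB.instance Definition _ := gen_eqMixin (form M k).
HB.instance Definition _ := gen_choiceMixin (form M k).

Fact form_zero_linear X (i : 'I_k) f (Y Z : vfield M) : 0 = f * 0 + 0 :> Cinf M.
Proof. by rewrite mulr0 addr0. Qed.
Definition form_zero : form M k :=
  @MkForm _ _ _ (fun=> 0) form_zero_linear (fun _ _ _ _ _ => erefl).

Fact form_add_linear w v X (i : 'I_k) f (Y Z : vfield M) :
  w (upd X i (f *: Y + Z)) + v (upd X i (f *: Y + Z)) =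
  f * (w (upd X i Y) + v (upd X i Y)) + (w (upd X i Z) + v (upd X i Z)).
Proof. by rewrite !form_linear mulrDr addrACA. Qed.
Fact form_add_alt w v X i j : i != j -> X i = X j -> w X + v X = 0.
Proof. by move=> ij Xij; rewrite !(form_alt _ ij Xij) addr0. Qed.
Definition form_add w v : form M k :=
  @MkForm _ _ _ (fun X => w X + v X) (form_add_linear w v) (form_add_alt w v).

Fact form_scale_linear h w X (i : 'I_k) f (Y Z : vfield M) :
  h * w (upd X i (f *: Y + Z)) = f * (h * w (upd X i Y)) + h * w (upd X i Z).
Proof. by rewrite form_linear mulrDr mulrCA. Qed.
Fact form_scale_alt (h : Cinf M) w X i j : i != j -> X i = X j -> h * w X = 0.
Proof. by move=> ij Xij; rewrite (form_alt _ ij Xij) mulr0. Qed.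
Definition form_scale h w : form M k :=
  @MkForm _ _ _ (fun X => h * w X) (form_scale_linear h w) (form_scale_alt h w).

Definition form_opp w : form M k := form_scale (-1) w.

Fact form_addA : associative form_add.
Proof. by move=> u v w; apply: form_ext => X; exact: addrA. Qed.
Fact form_addC : commutative form_add.
Proof. by move=> u v; apply: form_ext => X; exact: addrC. Qed.
Fact form_add0 : left_id form_zero form_add.
Proof. by move=> u; apply: form_ext => X; exact: add0r. Qed.
Fact form_addN : left_inverse form_zero form_opp form_add.
Proof. by move=> u; apply: form_ext => X; rewrite /= mulN1r addNr. Qed.
HB.instance Definition _ := GRing.isZmodule.Build (form M k)
  form_addA form_addC form_add0 form_addN.

Fact form_scaleA (f g : Cinf M) w :
  form_scale f (form_scale g w) = form_scale (f * g) w.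
Proof. by apply: form_ext => h; exact: mulrA. Qed.
Fact form_scale1 : left_id (1 : Cinf M) form_scale.
Proof. by move=> w; apply: form_ext => f; exact: mul1r. Qed.
Fact form_scaleDr : right_distributive form_scale +%R.
Proof. by move=> f w v; apply: form_ext => h; exact: mulrDr. Qed.
Fact form_scaleDl w : {morph form_scale^~ w : f g / f + g}.
Proof. by move=> f g; apply: form_ext => h; exact: mulrDl. Qed.
HB.instance Definition _ := GRing.Zmodule_isLmodule.Build (Cinf M) (form M k)
  form_scaleA form_scale1 form_scaleDr form_scaleDl.

Lemma formDE w v X : (w + v) X = w X + v X. Proof. by []. Qed.
Lemma formZE h w X : (h *: w) X = h * w X. Proof. by []. Qed.

Lemma form_updD w X i Y Z : w (upd X i (Y + Z)) = w (upd X i Y) + w (upd X i Z).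
Proof. by rewrite -[Y in LHS]scale1r form_linear mul1r. Qed.
Lemma form_upd0 w X i : w (upd X i 0) = 0.
Proof.
have := form_updD w X i 0 0; rewrite addr0 -{1}[w _]addr0 => /addrI e.
by rewrite -e.
Qed.
Lemma form_updZ w X i f Y : w (upd X i (f *: Y)) = f * w (upd X i Y).
Proof. by rewrite -[_ *: _]addr0 form_linear form_upd0 addr0. Qed.
Lemma form_updN w X i Y : w (upd X i (- Y)) = - w (upd X i Y).
Proof. by rewrite -scaleN1r form_updZ mulN1r. Qed.

Lemma form_tperm w X i j : i != j -> w (X \o tperm i j) = - w X.
Proof.
move=> ij; apply/eqP; rewrite -addr_eq0; apply/eqP.
have S (Y Z : vfield M) : w (upd (upd X i Y) j Z) + w (upd (upd X i Z) j Y) = 0.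
  have A (T : vfield M) : w (upd (upd X i T) j T) = 0.
    by apply: (form_alt w ij); rewrite upd_eq upd_neq // upd_eq.
  have := A (Y + Z); rewrite form_updD.
  rewrite !(updC _ _ _ ij) !form_updD -!(updC _ _ _ ij) !A addr0 add0r.
  by rewrite addrC.
rewrite -[RHS](S (X j) (X i)); congr (w _ + w _).
  apply/funext => l; rewrite /= /upd; case: tpermP => [->|->|/eqP li /eqP lj].
  - by rewrite (negbTE ij) eqxx.
  - by rewrite eqxx.
  - by rewrite (negbTE li) (negbTE lj).
by rewrite !upd_id.
Qed.

Lemma form_perm w X (s : 'S_k) : w (X \o s) = (-1) ^+ s * w X.
Proof.
have [ts -> ats] := prod_tpermP s; elim: ts ats X => [|[i j] ts IH] /= ats X.
  rewrite big_nil odd_perm1 mul1r; congr (w _).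
  by apply/funext => l; rewrite /= perm1.
case/andP: ats => ij ats; rewrite big_cons odd_permM odd_tperm ij signr_addb.
rewrite -mulrA -IH // mulN1r -(form_tperm _ _ ij); congr (w _).
by apply/funext => l; rewrite /= permM.
Qed.

End FormModule.

Lemma perm_lift_perm n (s : 'S_n.+1) i : exists t : 'S_n, s = lift_perm i (s i) t.
Proof.
have ulsf l : exists l', s (lift i l) = lift (s i) l'.
  have := neq_lift i l; rewrite -(inj_eq (@perm_inj _ s)).
  by move=> /unlift_some[l' -> _]; exists l'.
have [u uE] := choice ulsf.
have uI : injective u.
  by move=> l m lm; apply: (@lift_inj _ i); apply: (@perm_inj _ s); rewrite !uE lm.
exists (perm uI); apply/permP => l; case: (unliftP i l) => [l'|] ->.
  by rewrite lift_perm_lift permE uE.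
by rewrite lift_perm_id.
Qed.

Section ExteriorDerivative.
Context {R : realType} {M : manifold R} {k : nat} (w : form M k).
Implicit Types (X : 'I_k.+1 -> vfield M) (a b i j : 'I_k.+1) (f g : Cinf M).

(* The invariant formula
     dw(X_0,..,X_k) = \sum_i (-1)^i X_i (w(X_0,..,^X_i,..,X_k))
       + \sum_(i < j) (-1)^(i+j) w([X_i,X_j],X_0,..,^X_i,..,^X_j,..,X_k).
   Below [X_i,X_j] sits in the slot of X_j (slot j - 1 once X_i is omitted)
   instead of the first slot; this turns the sign (-1)^(i+j) into -(-1)^i. *)
Definition ext_d_fun X : Cinf M :=
  \sum_(i < k.+1) (-1) ^+ i * X i (w (X \o lift i)) -
  \sum_(i < k.+1) \sum_(j < k.+1 | (i < j)%N)
    (-1) ^+ i * w (upd X j (bracket (X i) (X j)) \o lift i).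

Lemma form_cycle X a b : a != b -> X a = X b ->
  (-1) ^+ b * w (X \o lift b) = - ((-1) ^+ a * w (X \o lift a)).
Proof.
move=> ab Xab; have [t tE] := perm_lift_perm (tperm a b) b.
have tb : tperm a b b = a by rewrite tpermR.
rewrite tb in tE.
have -> : X \o lift b = (X \o lift a) \o t.
  apply/funext => l; have := congr1 (fun s : 'S_k.+1 => s (lift b l)) tE.
  rewrite /= lift_perm_lift => <-.
  by case: tpermP => [->|->|//].
rewrite form_perm mulrA; have := congr1 (fun s : 'S_k.+1 => (s : bool)) tE.
rewrite /= odd_tperm ab odd_lift_perm => e.
have -> : (t : bool) = ~~ (odd a (+) odd b).
  by case: (t : bool) (odd a) (odd b) e => [] [] [].
rewrite -(signr_odd _ b) -signr_addb -(signr_odd _ a).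
by case: (odd a) (odd b) => [] [] /=; rewrite ?expr0 ?expr1 !(mul1r, mulN1r, opprK).
Qed.

Lemma form_cycle_upd X a b Y : a != b ->
  (-1) ^+ b * w (upd X a Y \o lift b) = - ((-1) ^+ a * w (upd X b Y \o lift a)).
Proof.
move=> ab; have := @form_cycle (upd (upd X a Y) b Y) a b ab.
rewrite upd_eq upd_neq // upd_eq => /(_ erefl).
by rewrite upd_lift_same updC // upd_lift_same.
Qed.

Let F X (i j : 'I_k.+1) : Cinf M := (-1) ^+ i * w (upd X j (bracket (X i) (X j)) \o lift i).

Let F_sym X i j : i != j -> F X i j = F X j i.
Proof.
move=> ij; rewrite /F (form_cycle_upd _ _ ij) bracketC.
have /unlift_some[l -> _] := ij.
by rewrite upd_lift form_updN -upd_lift mulrN.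
Qed.

Let sum_sym (H : 'I_k.+1 -> 'I_k.+1 -> Cinf M) :
  (forall i j, i != j -> H i j = H j i) ->
  \sum_(i < k.+1) \sum_(j < k.+1 | i != j) H i j =
  \sum_(i < k.+1) \sum_(j < k.+1 | (i < j)%N) H i j + \sum_(i < k.+1) \sum_(j < k.+1 | (i < j)%N) H i j.
Proof.
move=> Hs; rewrite [X in _ + X](exchange_big_dep xpredT) //= -big_split /=.
apply: eq_bigr => i _; rewrite (bigID (fun j : 'I__ => (i < j)%N)) /=.
congr (_ + _); last first.
  apply: eq_big => [j|j /andP[ij _]]; last exact: Hs.
  by rewrite -leqNgt ltn_neqAle eq_sym.
by apply: eq_bigl => j; rewrite ltn_neqAle andbA andbb.
Qed.

Fact ext_d_alt X a b : a != b -> X a = X b -> ext_d_fun X = 0.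
Proof.
move=> ab Xab.
have main (G : 'I_k.+1 -> Cinf M) : (forall i, i != a -> i != b -> G i = 0) ->
    G b = - G a -> \sum_(i < k.+1) G i = 0.
  move=> G0 Gb; rewrite (bigD1 a) //= (bigD1 b) 1?eq_sym //= Gb addrA subrr add0r.
  by apply: big1 => i /andP[ia ib]; exact: G0.
have -> : ext_d_fun X = \sum_(i < k.+1) (-1) ^+ i * X i (w (X \o lift i)) -
  \sum_(i < k.+1) \sum_(j < k.+1 | (i < j)%N) F X i j by [].
rewrite (main (fun i => _ * _)); last 2 first.
- move=> i ia ib; rewrite (_ : w _ = 0) ?vact0 ?mulr0 //.
  have /unlift_some[a' ea _] := ia; have /unlift_some[b' eb _] := ib.
  apply: (@form_alt _ _ _ w _ a' b'); last by rewrite /= -ea -eb.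
  by apply: contra_neq ab => e; rewrite ea eb e.
- have /(congr1 (X a)) := form_cycle ab Xab.
  rewrite vactN -Xab.
  have sg (n : nat) (Y : vfield M) f : Y ((-1) ^+ n * f) = (-1) ^+ n * Y f.
    rewrite -signr_odd; case: (odd n); rewrite ?expr0 ?mul1r //.
    by rewrite expr1 !mulN1r vactN.
  by rewrite !sg.
rewrite sub0r; apply/eqP; rewrite oppr_eq0; apply/eqP.
apply: Cinf_halve; rewrite -sum_sym; last exact: F_sym.
apply: main => [i ia ib|].
  rewrite (bigD1 a) //= (bigD1 b) /=; last by rewrite ib eq_sym.
  rewrite [X in _ + (_ + X)]big1 ?addr0; last first.
    move=> j /andP[/andP[ij ja] jb]; rewrite /F (_ : w _ = 0) ?mulr0 //.
    have /unlift_some[a' ea _] := ia; have /unlift_some[b' eb _] := ib.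
    apply: (@form_alt _ _ _ w _ a' b'); first by apply: contra_neq ab => e; rewrite ea eb e.
    by rewrite /= -ea -eb !upd_neq // eq_sym.
  rewrite /F -mulrDr -Xab.
  have /unlift_some[a' ea _] := ia; have /unlift_some[b' eb _] := ib.
  have a'b' : a' != b' by apply: contra_neq ab => e; rewrite ea eb e.
  rewrite ea eb !upd_lift -ea.
  set Z := bracket _ _.
  have -> : upd (X \o lift i) b' Z = upd (X \o lift i) a' Z \o tperm a' b'.
    apply/funext => l; rewrite /= /upd.
    case: tpermP => [->|->|/eqP la /eqP lb].
    - by rewrite (negbTE a'b') eq_sym (negbTE a'b') /= -ea -eb.
    - by rewrite !eqxx.
    - by rewrite (negbTE la) (negbTE lb).
  by rewrite form_tperm // subrr mulr0.
rewrite (bigD1 a) 1?eq_sym //= [in RHS](bigD1 b) //= opprD; congr (_ + _).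
  rewrite /F Xab (_ : bracket _ _ = 0); last first.
    by apply: vfield_ext => f; rewrite bracketE subrr.
  have /unlift_some[b' eb _] := ab; rewrite eq_sym in ab.
  have /unlift_some[a' ea _] := ab.
  by rewrite eb upd_lift form_upd0 -eb ea upd_lift form_upd0 !mulr0 oppr0.
rewrite -sumrN; apply: eq_big => [j|j /andP[bj ja]].
  by rewrite ![_ == j]eq_sym andbC.
rewrite /F Xab; have := @form_cycle (upd X j (bracket (X b) (X j))) a b ab.
rewrite !upd_neq // ?[_ == j]eq_sym // 1?eq_sym //.
exact.
Qed.

Fact ext_d_linear X a f (Y Z : vfield M) :
  ext_d_fun (upd X a (f *: Y + Z)) =
  f * ext_d_fun (upd X a Y) + ext_d_fun (upd X a Z).
Proof.
pose e (i : 'I_k.+1) : Cinf M := (-1) ^+ i * X i f * w (upd X a Y \o lift i).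
have E1 (i : 'I_k.+1) : (-1) ^+ i * upd X a (f *: Y + Z) i (w (upd X a (f *: Y + Z) \o lift i))
  = f * ((-1) ^+ i * upd X a Y i (w (upd X a Y \o lift i)))
    + (-1) ^+ i * upd X a Z i (w (upd X a Z \o lift i))
    + (if i == a then 0 else e i).
  case: (eqVneq i a) => [->|ia].
    by rewrite !upd_lift_same !upd_eq vfieldDE vfieldZE; ring.
  rewrite !(upd_neq _ _ ia) /e; have /unlift_some[l -> _] := ia.
  by rewrite !upd_lift form_linear vactD vact_leibniz; ring.
have E2 (i j : 'I_k.+1) : (i < j)%N -> F (upd X a (f *: Y + Z)) i j =
    f * F (upd X a Y) i j + F (upd X a Z) i j +
    ((if j == a then e i else 0) + (if i == a then e j else 0)).
  move=> ij; have nij : i != j by rewrite neq_ltn ij.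
  have nji : j != i by rewrite eq_sym.
  rewrite /F; case: (eqVneq j a) => [ja|ja].
    rewrite -ja (negbTE nij) !upd_eq !(upd_neq _ _ nij) !upd_upd bracketr /e -ja.
    have /unlift_some[l -> _] := nij.
    by rewrite !upd_lift !form_updD !form_updZ; ring.
  case: (eqVneq i a) => [ia|ia]; last first.
    rewrite !(upd_neq _ _ ja) !(upd_neq _ _ ia) !(updC _ _ _ (_ : a != j)) 1?eq_sym //.
    have /unlift_some[l -> _] := ia.
    by rewrite !upd_lift form_linear; ring.
  rewrite -ia !upd_eq !(upd_neq _ _ nji) /e -ia.
  rewrite mulrAC (form_cycle_upd _ _ nij).
  rewrite !(updC _ _ _ nij) !upd_lift_same bracketl.
  have /unlift_some[l -> _] := nij.
  by rewrite !upd_lift !form_updD form_updN !form_updZ; ring.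
have KE X0 : ext_d_fun X0 = \sum_(i < k.+1) (-1) ^+ i * X0 i (w (X0 \o lift i)) -
  \sum_(i < k.+1) \sum_(j < k.+1 | (i < j)%N) F X0 i j by [].
rewrite !KE (eq_bigr _ (fun i _ => E1 i)) !big_split /= -mulr_sumr.
have -> : \sum_(i < k.+1) \sum_(j < k.+1 | (i < j)%N) F (upd X a (f *: Y + Z)) i j =
   f * (\sum_(i < k.+1) \sum_(j < k.+1 | (i < j)%N) F (upd X a Y) i j) +
   \sum_(i < k.+1) \sum_(j < k.+1 | (i < j)%N) F (upd X a Z) i j +
   \sum_(i < k.+1) (if i == a then 0 else e i).
  under eq_bigr => i _ do rewrite (eq_bigr _ (fun j => @E2 i j)) !big_split /= -mulr_sumr.
  rewrite !big_split /= -mulr_sumr; congr (_ + _).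
  rewrite (exchange_big_dep xpredT) //= -big_split /=.
  have -> : \sum_(i < k.+1) (if i == a then 0 else e i) =
     \sum_(i < k.+1 | (i < a)%N) e i + \sum_(i < k.+1 | (a < i)%N) e i.
    rewrite [X in X + _]big_mkcond [X in _ + X]big_mkcond -big_split /=.
    apply: eq_bigr => i _; case: (ltngtP i a) => [ia|ia|ia].
    - by rewrite -val_eqE /= ltn_eqF ?addr0.
    - by rewrite -val_eqE /= gtn_eqF ?add0r.
    - by rewrite -val_eqE /= ia eqxx addr0.
  rewrite big_split /=; congr (_ + _).
    rewrite (bigD1 a) //= eqxx [X in _ + X]big1 ?addr0 // => j ja.
    by rewrite big1 // => i _; rewrite (negbTE ja).
  rewrite (bigD1 a) //= [X in _ + X]big1 ?addr0; last first.
    by move=> j ja; rewrite big1 // => i _; rewrite (negbTE ja).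
  by apply: eq_bigr => j _; rewrite eqxx.
by ring.
Qed.

Definition ext_d : form M k.+1 := MkForm ext_d_linear ext_d_alt.

End ExteriorDerivative.

(* The 0-form of a smooth function; [form M 0] is identified with [Cinf M]
   through [form0] and its inverse [form0_val]. *)
Section Form0.
Context {R : realType} {M : manifold R}.

Fact form0_linear (f : Cinf M) (X : 'I_0 -> vfield M) (i : 'I_0) (g : Cinf M)
  (Y Z : vfield M) : f = g * f + f.
Proof. by case: i. Qed.
Fact form0_alt (f : Cinf M) (X : 'I_0 -> vfield M) (i j : 'I_0) :
  i != j -> X i = X j -> f = 0.
Proof. by case: i. Qed.
Definition form0 (f : Cinf M) : form M 0 :=
  @MkForm _ _ _ (fun=> f) (form0_linear f) (form0_alt f).

Definition form0_val (w : form M 0) : Cinf M := w (fun=> 0).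

Lemma form0K f : form0_val (form0 f) = f. Proof. by []. Qed.
Lemma form0_valK w : form0 (form0_val w) = w.
Proof. by apply: form_ext => X; congr (w _); apply/funext => -[]. Qed.

Lemma ext_d_form0 f X : ext_d (form0 f) X = X ord0 f.
Proof.
rewrite /= /ext_d_fun !big_ord1 /= mul1r [X in _ - X]big1 ?subr0 //.
by move=> j; rewrite ord1.
Qed.

End Form0.

Lemma upd_comp_inj (T : Type) n m (X : 'I_n -> T) (h : 'I_m -> 'I_n) i Y :
  injective h -> upd X (h i) Y \o h = upd (X \o h) i Y.
Proof. by move=> hI; apply/funext => j; rewrite /upd /= (inj_eq hI). Qed.

Lemma upd_comp_out (T : Type) n m (X : 'I_n -> T) (h : 'I_m -> 'I_n) i Y :
  (forall j, h j != i) -> upd X i Y \o h = X \o h.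
Proof. by move=> hi; apply/funext => j; rewrite /= upd_neq. Qed.

Section Wedge.
Context {R : realType} {M : manifold R} {k l m : nat} (e : (k + l)%N = m).
Implicit Types (a : form M k) (b : form M l) (X : 'I_m -> vfield M).
Implicit Type f : Cinf M.

Let wl (i : 'I_k) : 'I_m := cast_ord e (lshift l i).
Let wr (j : 'I_l) : 'I_m := cast_ord e (rshift k j).

(* The degree of the product is m = k + l, up to the equation e. The factor
   1 / (k! l!) is the normalization for which [ext_d] is an antiderivation. *)
Definition wedge_fun a b X : Cinf M :=
  Cinf_cst ((k`! * l`!)%:R^-1) *
  \sum_(s : 'S_m) (-1) ^+ s *
    (a (fun i => X (s (cast_ord e (lshift l i)))) *
     b (fun j => X (s (cast_ord e (rshift k j))))).

Let wl_inj : injective wl.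
Proof. by move=> i j /cast_ord_inj /lshift_inj. Qed.
Let wr_inj : injective wr.
Proof. by move=> i j /cast_ord_inj /rshift_inj. Qed.
Let wlr i j : wl i != wr j.
Proof. by rewrite -val_eqE /= neq_ltn (leq_trans (ltn_ord i)) ?leq_addr. Qed.
Let wP (c : 'I_m) : (exists i, c = wl i) \/ (exists j, c = wr j).
Proof.
rewrite -[c](cast_ordKV e); case: (split_ordP (cast_ord (esym e) c)) => [i|j] ->.
  by left; exists i.
by right; exists j.
Qed.

Fact wedge_linear a b X i f (Y Z : vfield M) :
  wedge_fun a b (upd X i (f *: Y + Z)) =
  f * wedge_fun a b (upd X i Y) + wedge_fun a b (upd X i Z).
Proof.
rewrite /wedge_fun mulrCA -mulrDr; congr (_ * _).
rewrite mulr_sumr -big_split /=; apply: eq_bigr => s _.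
have E V (h : form M k) : h (fun i0 => upd X i V (s (wl i0))) =
    h (upd (X \o s) ((s^-1)%g i) V \o wl).
  by congr (h _); apply/funext => i0; rewrite -upd_perm.
have E' V (h : form M l) : h (fun i0 => upd X i V (s (wr i0))) =
    h (upd (X \o s) ((s^-1)%g i) V \o wr).
  by congr (h _); apply/funext => i0; rewrite -upd_perm.
rewrite -!/(wl _) -!/(wr _) !E !E'.
have [[i0 ->]|[j0 ->]] := wP ((s^-1)%g i).
  rewrite !(upd_comp_inj _ _ _ wl_inj) !(@upd_comp_out _ _ _ _ wr); last first.
  - by move=> j; rewrite eq_sym.
  - by move=> j; rewrite eq_sym.
  - by move=> j; rewrite eq_sym.
  by rewrite form_linear; move: ((-1) ^+ s) => sg; ring.
rewrite !(upd_comp_inj _ _ _ wr_inj) !(@upd_comp_out _ _ _ _ wl) //.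
by rewrite form_linear; move: ((-1) ^+ s) => sg; ring.
Qed.

Fact wedge_alt a b X i j : i != j -> X i = X j -> wedge_fun a b X = 0.
Proof.
move=> ij Xij; rewrite /wedge_fun [X in _ * X](_ : _ = 0) ?mulr0 //.
apply: Cinf_halve.
rewrite [X in X + _](reindex_inj (mulIg (tperm i j))) -big_split /=.
apply: big1 => s _; rewrite odd_permM odd_tperm ij signr_addb.
have Xt c : X (tperm i j c) = X c by case: tpermP => [->|->|].
have -> : (fun i0 => X ((s * tperm i j)%g (cast_ord e (lshift l i0)))) =
   (fun i0 => X (s (cast_ord e (lshift l i0)))).
  by apply/funext => i0; rewrite permM Xt.
have -> : (fun i0 => X ((s * tperm i j)%g (cast_ord e (rshift k i0)))) =
   (fun i0 => X (s (cast_ord e (rshift k i0)))).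
  by apply/funext => i0; rewrite permM Xt.
by rewrite expr1; move: ((-1) ^+ s) => sg; ring.
Qed.

Definition wedge a b : form M m :=
  MkForm (wedge_linear a b) (wedge_alt a b).

Lemma wedgeDr a b b' f :
  wedge a (f *: b + b') = f *: wedge a b + wedge a b'.
Proof.
apply: form_ext => X; rewrite formDE formZE /= /wedge_fun mulrCA -mulrDr.
congr (_ * _); rewrite mulr_sumr -big_split /=; apply: eq_bigr => s _.
by rewrite ?formDE ?formZE; move: ((-1) ^+ s) => sg; ring.
Qed.

Lemma wedgeZr a b f : wedge a (f *: b) = f *: wedge a b.
Proof.
apply: form_ext => X; rewrite formZE /= /wedge_fun mulrCA; congr (_ * _).
rewrite mulr_sumr; apply: eq_bigr => s _.
by rewrite ?formZE; move: ((-1) ^+ s) => sg; ring.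
Qed.

Lemma wedgeDl a a' b f :
  wedge (f *: a + a') b = f *: wedge a b + wedge a' b.
Proof.
apply: form_ext => X; rewrite formDE formZE /= /wedge_fun mulrCA -mulrDr.
congr (_ * _); rewrite mulr_sumr -big_split /=; apply: eq_bigr => s _.
by rewrite ?formDE ?formZE; move: ((-1) ^+ s) => sg; ring.
Qed.

End Wedge.

Section Tensor.
Local Open Scope quotient_scope.
Local Notation repr := generic_quotient.repr.
Context {A : comPzRingType} {U V : lmodType A}.
Implicit Types (s t : seq (U * V)) (u : U) (v : V) (a : A).

(* The sequence [:: (u_1, v_1); ..; (u_n, v_n)] stands for the formal sum
   u_1 (x) v_1 + .. + u_n (x) v_n. *)
Inductive tens_eq : seq (U * V) -> seq (U * V) -> Prop :=
| TensRefl s : tens_eq s s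
| TensSym s t : tens_eq s t -> tens_eq t s
| TensTrans t s r : tens_eq s t -> tens_eq t r -> tens_eq s r
| TensCat s s' t t' :
    tens_eq s s' -> tens_eq t t' -> tens_eq (s ++ t) (s' ++ t')
| TensC s t : tens_eq (s ++ t) (t ++ s)
| Tens0 v : tens_eq [:: (0, v)] [::]
| TensDl u u' v : tens_eq [:: (u + u', v)] [:: (u, v); (u', v)]
| TensDr u v v' : tens_eq [:: (u, v + v')] [:: (u, v); (u, v')]
| TensZ a u v : tens_eq [:: (a *: u, v)] [:: (u, a *: v)].

Definition tens_rel s t := `[< tens_eq s t >].

Fact tens_rel_refl : reflexive tens_rel.
Proof. by move=> s; apply/asboolP; exact: TensRefl. Qed.
Fact tens_rel_sym : symmetric tens_rel.
Proof. by move=> s t; apply/asboolP/asboolP; exact: TensSym. Qed.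
Fact tens_rel_trans : transitive tens_rel.
Proof. by move=> t s r /asboolP st /asboolP tr; apply/asboolP; exact: TensTrans tr. Qed.

Canonical tens_equiv := EquivRel tens_rel tens_rel_refl tens_rel_sym tens_rel_trans.
Definition tensor := {eq_quot tens_equiv}.
HB.instance Definition _ := Choice.on tensor.

Definition tens_pi s : tensor := \pi_{eq_quot tens_equiv} s.

Lemma tens_piP s t : tens_pi s = tens_pi t <-> tens_eq s t.
Proof.
split=> [/eqP|st]; first by rewrite /tens_pi eqmodE => /asboolP.
by apply/eqP; rewrite /tens_pi eqmodE; apply/asboolP.
Qed.

Lemma tens_repr (x : tensor) : tens_pi (repr x) = x.
Proof. exact: reprK. Qed.

Lemma tens_reprP s : tens_eq (repr (tens_pi s)) s.
Proof. by apply/tens_piP; rewrite tens_repr. Qed.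

Definition tens (u : U) (v : V) : tensor := tens_pi [:: (u, v)].
Definition tens_zero : tensor := tens_pi [::].
Definition tens_add (x y : tensor) : tensor := tens_pi (repr x ++ repr y).
Definition tens_map_scale a s := [seq (a *: z.1, z.2) | z <- s].
Definition tens_scale a (x : tensor) : tensor :=
  tens_pi (tens_map_scale a (repr x)).
Definition tens_opp (x : tensor) : tensor := tens_scale (-1) x.

Lemma tens_map_scale_eq a s t :
  tens_eq s t -> tens_eq (tens_map_scale a s) (tens_map_scale a t).
Proof.
elim=> {s t}.
- by move=> s; exact: TensRefl.
- by move=> s t _; exact: TensSym.
- by move=> t s r _ st _; exact: TensTrans.
- by move=> s s' t t' _ st _ st'; rewrite /tens_map_scale !map_cat; exact: TensCat.
- by move=> s t; rewrite /tens_map_scale !map_cat; exact: TensC.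
- by move=> v; rewrite /= scaler0; exact: Tens0.
- by move=> u u' v; rewrite /= scalerDr; exact: TensDl.
- by move=> u v v'; exact: TensDr.
- move=> b u v; rewrite /= scalerA mulrC -scalerA; exact: TensZ.
Qed.

Lemma tens_addE s t : tens_add (tens_pi s) (tens_pi t) = tens_pi (s ++ t).
Proof. by apply/tens_piP; apply: TensCat; exact: tens_reprP. Qed.

Lemma tens_scaleE a s : tens_scale a (tens_pi s) = tens_pi (tens_map_scale a s).
Proof. by apply/tens_piP; apply: tens_map_scale_eq; exact: tens_reprP. Qed.

Lemma tens_cons_eq z s t : tens_eq s t -> tens_eq (z :: s) (z :: t).
Proof. by move=> st; apply: (@TensCat [:: z] [:: z]) => //; exact: TensRefl. Qed.

Fact tens_addA : associative tens_add.
Proof.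
move=> x y z; rewrite -[x]tens_repr -[y]tens_repr -[z]tens_repr.
by rewrite !tens_addE catA.
Qed.
Fact tens_addC : commutative tens_add.
Proof.
move=> x y; rewrite -[x]tens_repr -[y]tens_repr !tens_addE.
by apply/tens_piP; exact: TensC.
Qed.
Fact tens_add0 : left_id tens_zero tens_add.
Proof. by move=> x; rewrite -[x]tens_repr /tens_zero tens_addE. Qed.
Lemma tens_consC z s t : tens_eq (z :: s ++ t) (s ++ z :: t).
Proof.
rewrite -cat_cons -cat_rcons -cats1; apply: TensCat (TensRefl _).
exact: (@TensC [:: z] s).
Qed.

Fact tens_scaleDl x a b :
  tens_scale (a + b) x = tens_add (tens_scale a x) (tens_scale b x).
Proof.
rewrite -[x]tens_repr !tens_scaleE tens_addE.
apply/tens_piP; elim: (repr x) => [|[u v] s IH] /=; first exact: TensRefl.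
rewrite scalerDl; apply: TensTrans (TensCat (TensDl _ _ _) IH) _ => /=.
by apply: tens_cons_eq; exact: tens_consC.
Qed.
Fact tens_scale1 x : tens_scale 1 x = x.
Proof.
rewrite -[x]tens_repr tens_scaleE; congr tens_pi; rewrite -[RHS]map_id.
by apply: eq_map => -[u v]; rewrite scale1r.
Qed.
Fact tens_scale0 x : tens_scale 0 x = tens_zero.
Proof.
rewrite -[x]tens_repr tens_scaleE; apply/tens_piP.
elim: (repr x) => [|[u v] s IH] /=; first exact: TensRefl.
by rewrite scale0r; exact: (@TensCat [:: _] [::] _ [::] (Tens0 v) IH).
Qed.
Fact tens_addN : left_inverse tens_zero tens_opp tens_add.
Proof.
by move=> x; rewrite -{2}[x]tens_scale1 /tens_opp -tens_scaleDl addNr tens_scale0.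
Qed.
HB.instance Definition _ := GRing.isZmodule.Build tensor
  tens_addA tens_addC tens_add0 tens_addN.

Fact tens_scaleA a b x : tens_scale a (tens_scale b x) = tens_scale (a * b) x.
Proof.
rewrite -[x]tens_repr !tens_scaleE; congr tens_pi; rewrite /tens_map_scale.
by rewrite -map_comp; apply: eq_map => -[u v] /=; rewrite scalerA.
Qed.
Fact tens_scaleDr : right_distributive tens_scale +%R.
Proof.
move=> a x y; rewrite -[x]tens_repr -[y]tens_repr.
rewrite -[_ + _]/(tens_add _ _) -[_ + _ in RHS]/(tens_add _ _).
by rewrite tens_addE !tens_scaleE tens_addE /tens_map_scale map_cat.
Qed.
Fact tens_scaleD x : {morph tens_scale^~ x : a b / a + b}.
Proof. by move=> a b; exact: tens_scaleDl. Qed.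
HB.instance Definition _ := GRing.Zmodule_isLmodule.Build A tensor
  tens_scaleA tens_scale1 tens_scaleDr tens_scaleD.

Lemma tens_pi_sum s : tens_pi s = \sum_(z <- s) tens z.1 z.2.
Proof.
elim: s => [|[u v] s IH]; first by rewrite big_nil.
by rewrite big_cons -IH -[_ + _]/(tens_add _ _) tens_addE.
Qed.

Lemma tensE (x : tensor) : x = \sum_(z <- repr x) tens z.1 z.2.
Proof. by rewrite -tens_pi_sum tens_repr. Qed.

Lemma tensDl u u' v : tens (u + u') v = tens u v + tens u' v.
Proof. by rewrite -[RHS]/(tens_add _ _) tens_addE; apply/tens_piP/TensDl. Qed.
Lemma tensDr u v v' : tens u (v + v') = tens u v + tens u v'.
Proof. by rewrite -[RHS]/(tens_add _ _) tens_addE; apply/tens_piP/TensDr. Qed.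
Lemma tensZl a u v : tens (a *: u) v = a *: tens u v.
Proof. by rewrite -[RHS]/(tens_scale _ _) tens_scaleE. Qed.
Lemma tensZr a u v : tens u (a *: v) = a *: tens u v.
Proof. by rewrite -tensZl; apply/esym/tens_piP/TensZ. Qed.
Lemma tens0l v : tens 0 v = 0. Proof. exact/tens_piP/Tens0. Qed.
Lemma tens0r u : tens u 0 = 0.
Proof. by rewrite -(scale0r 0) tensZr scale0r. Qed.

(* The additive map out of the tensor product with u (x) v |-> b u v, provided b
   is biadditive and b (a *: u) v = b u (a *: v). *)
Definition tens_lift (W : zmodType) (b : U -> V -> W) (x : tensor) : W :=
  \sum_(z <- repr x) b z.1 z.2.

Section Lift.
Context {W : zmodType} (b : U -> V -> W)
  (bDl : forall u u' v, b (u + u') v = b u v + b u' v)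
  (bDr : forall u v v', b u (v + v') = b u v + b u v')
  (bZ : forall a u v, b (a *: u) v = b u (a *: v)).

Lemma tens_lift_eq s t : tens_eq s t ->
  \sum_(z <- s) b z.1 z.2 = \sum_(z <- t) b z.1 z.2.
Proof.
have b0 v : b 0 v = 0.
  by have := bDl 0 0 v; rewrite addr0 -{1}[b 0 v]addr0 => /addrI.
elim=> {s t} //.
- by move=> t s r _ -> _ ->.
- by move=> s s' t t' _ E _ E'; rewrite !big_cat /= E E'.
- by move=> s t; rewrite !big_cat /= addrC.
- by move=> v; rewrite big_seq1 big_nil.
- by move=> u u' v; rewrite !big_cons !big_nil /= !addr0 bDl.
- by move=> u v v'; rewrite !big_cons !big_nil /= !addr0 bDr.
- by move=> a u v; rewrite !big_seq1 /= bZ.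
Qed.

Lemma tens_liftE u v : tens_lift b (tens u v) = b u v.
Proof. by rewrite /tens_lift (tens_lift_eq (tens_reprP _)) big_seq1. Qed.

Lemma tens_liftD x y : tens_lift b (x + y) = tens_lift b x + tens_lift b y.
Proof.
rewrite /tens_lift -[x + y]/(tens_add x y) (tens_lift_eq (tens_reprP _)).
by rewrite big_cat.
Qed.

End Lift.

End Tensor.
Arguments tensor {A} U V.

Section BundleForms.
Context {R : realType} {M : manifold R}.

Definition tform (xi : vbundle M) (k : nat) : lmodType (Cinf M) :=
  tensor (form M k) (section xi).

Definition bform (xi : vbundle M) (k : nat) : lmodType (Cinf M) :=
  if k is k'.+1 then tform xi k'.+1 else section xi.

Context {xi : vbundle M}.

(* The generator w (x) s of [bform xi k]; for k = 0 it is the section w s. *)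
Definition btens (k : nat) : form M k -> section xi -> bform xi k :=
  match k return form M k -> section xi -> bform xi k with
  | 0 => fun w s => form0_val w *: s
  | k'.+1 => fun w s => tens w s
  end.

Definition bhom_tform (P : bhom xi) k (x : tform xi k) : tform xi k :=
  tens_lift (fun w s => tens w (bhom_section P s)) x.

Definition bhom_act (P : bhom xi) (k : nat) : bform xi k -> bform xi k :=
  match k return bform xi k -> bform xi k with
  | 0 => bhom_section P
  | k'.+1 => @bhom_tform P k'.+1
  end.

Definition twedge k l m (e : (k + l)%N = m) (b : form M k) (x : tform xi l) :
  tform xi m := tens_lift (fun w s => tens (wedge e b w) s) x.

Lemma bhom_tformE P k (w : form M k) (s : section xi) :
  bhom_tform P (tens w s) = tens w (bhom_section P s).
Proof.
rewrite /bhom_tform tens_liftE // => [u u' v|u v v'|a u v].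
- by rewrite tensDl.
- by rewrite -[v]scale1r bhom_section_linear !scale1r tensDr.
- by rewrite -[a *: v]addr0 bhom_section_linear tensDr tensZr tensZl bhom_section0
  tens0r addr0.
Qed.

Lemma bhom_tformD P k (x y : tform xi k) :
  bhom_tform P (x + y) = bhom_tform P x + bhom_tform P y.
Proof.
apply: tens_liftD => [u u' v|u v v'|a u v].
- by rewrite tensDl.
- by rewrite -[v]scale1r bhom_section_linear !scale1r tensDr.
- by rewrite -[a *: v]addr0 bhom_section_linear tensDr tensZr tensZl bhom_section0
  tens0r addr0.
Qed.

Lemma twedgeE k l m (e : (k + l)%N = m) b (w : form M l) (s : section xi) :
  twedge e b (tens w s) = tens (wedge e b w) s.
Proof.
rewrite /twedge tens_liftE // => [u u' v|u v v'|a u v].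
- by rewrite -[u]scale1r wedgeDr !scale1r tensDl.
- by rewrite tensDr.
- by rewrite wedgeZr tensZl tensZr.
Qed.

Lemma twedgeD k l m (e : (k + l)%N = m) b (x y : tform xi l) :
  twedge e b (x + y) = twedge e b x + twedge e b y.
Proof.
apply: tens_liftD => [u u' v|u v v'|a u v].
- by rewrite -[u]scale1r wedgeDr !scale1r tensDl.
- by rewrite tensDr.
- by rewrite wedgeZr tensZl tensZr.
Qed.

(* R-linearity is stated through the constant functions. *)
Record pseudoconnection (P : bhom xi) := MkPseudoconnection {
  pconn :> section xi -> bform xi 1;
  pconn_linear : forall c (s t : section xi),
    pconn (Cinf_cst c *: s + t) = Cinf_cst c *: pconn s + pconn t;
  pconn_leibniz : forall (f : Cinf M) (s : section xi),
    pconn (f *: s) =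
      btens (ext_d (form0 f)) (bhom_section P s) + f *: pconn s
}.

(* D is determined by these conditions: see [ext_derivative_unique]. *)
Record is_ext_derivative (P : bhom xi) (nabla : pseudoconnection P)
    (D : forall k, bform xi k -> bform xi k.+1) : Prop := IsExtDerivative {
  extd_zero : forall s, D 0 s = nabla s;
  extd_linear : forall k c (x y : bform xi k),
    D k (Cinf_cst c *: x + y) = Cinf_cst c *: D k x + D k y;
  extd_gen : forall k (w : form M k) (s : section xi),
    D k (btens w s) =
      btens (ext_d w) (bhom_section P s) +
      (-1) ^+ k *: twedge (addn1 k) w (nabla s)
}.

Lemma ext_derivative_unique (P : bhom xi) (nabla : pseudoconnection P)
    (D D' : forall k, bform xi k -> bform xi k.+1) :
  is_ext_derivative nabla D -> is_ext_derivative nabla D' ->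
  forall k x, D k x = D' k x.
Proof.
move=> [D0 Dl Dg] [D0' Dl' Dg'] [|k] x; first by rewrite D0 D0'.
have add E : (forall c (x y : bform xi k.+1),
    E (Cinf_cst c *: x + y) = Cinf_cst c *: E x + E y) ->
    (forall x y, E (x + y) = E x + E y :> bform xi k.+2) /\ E 0 = 0.
  move=> El; have c1 : Cinf_cst 1 = 1 :> Cinf M by exact: Cinf_ext.
  have Ea u v : E (u + v) = E u + E v.
    by have := El 1 u v; rewrite c1 !scale1r.
  by split=> //; have := Ea 0 0; rewrite addr0 -{1}[E 0]addr0 => /addrI.
have [a a0] := add _ (Dl k.+1); have [a' a0'] := add _ (Dl' k.+1).
rewrite [x]tensE; elim: (generic_quotient.repr _) => [|[w s] r IH].
  by rewrite big_nil a0 a0'.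
by rewrite big_cons a a' IH (Dg k.+1 w s) (Dg' k.+1 w s).
Qed.

Definition Fcurv (P : bhom xi) (nabla : pseudoconnection P)
    (D : forall k, bform xi k -> bform xi k.+1) (s : section xi) : bform xi 2 :=
  bhom_act P (D 1 (nabla s)) - D 1 (bhom_act P (nabla s)) +
  D 1 (nabla (bhom_section P s)).

Definition is_chain_complex (D : forall k, bform xi k -> bform xi k.+1) : Prop :=
  forall k x, D k.+1 (D k x) = 0.

End BundleForms.

(* Main.v *)
(* A pseudoconnection with principal homomorphism 0 is just a linear map over
   the smooth functions, and every term of F vanishes because it has a factor
   P. On the other hand, on a trivial bundle over R^2 the map
   s |-> dx (x) s A + dy (x) s B, with A and B constant matrices acting on row
   vectors, has d d s = (dx /\ dy) (x) s (B A - A B), which is nonzero for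
   suitable s once A and B do not commute. *)
From mathcomp Require Import all_boot all_order all_algebra all_fingroup.
From mathcomp Require Import boolp classical_sets functions cardinality reals.
From mathcomp Require Import topology normedtype derive.
Require Import Defs.
Set Implicit Arguments. Unset Strict Implicit. Unset Printing Implicit Defensive.
Import Order.TTheory GRing.Theory Num.Theory.
Import numFieldNormedType.Exports.
Local Open Scope classical_set_scope.
Local Open Scope ring_scope.

(** * Euclidean space as a manifold, with its partial derivatives and coordinate one-forms *)

Section EuclideanSpace.
Context {R : realType} {n : nat}.

(** Balls with rational centre and radius form a base: inside the ball of radius [e] about [x], take
    a rational [r < e / 2] and a rational centre within [r] of [x]; the triangle inequality does the
    rest. *)
Lemma rV_second_countable : @second_countable 'rV[R]_n.
Proof.
pose U (z : 'rV[rat]_n * rat) : set 'rV[R]_n :=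
  ball (map_mx ratr z.1 : 'rV[R]_n) (ratr z.2).
exists (range U); first exact: card_le_trans (card_image_le _ _) (countableP _).
split=> [_ [z _ <-]|x V /nbhs_ballP[e /= e0 eV]]; first exact: ball_open.
have /rat_in_itvoo[r] : 0 < e / 2 by rewrite divr_gt0.
rewrite in_itv /= => /andP[r0 re].
have /choice[q qx] (j : 'I_n) : exists q : rat, `|ratr q - x 0 j| < ratr r.
  have /rat_in_itvoo[q] : x 0 j - ratr r < x 0 j + ratr r.
    by rewrite ltrBlDr -addrA ltrDl addr_gt0.
  by rewrite in_itv /= -ltr_distl => qr; exists q.
have qxr : ball (map_mx ratr (\row_j q j) : 'rV[R]_n) (ratr r) x.
  by split=> // i j; rewrite ord1 !mxE -ball_normE; exact: qx.
exists (U (\row_j q j, r)); first by split=> //; exists (\row_j q j, r).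
move=> y /= qy; apply: eV; apply: (@le_ball _ _ _ (ratr r + ratr r)).
  by rewrite (splitr e) lerD // ltW.
exact: ball_triangle (ball_sym qxr) qy.
Qed.

Lemma derive_coord (x v : 'rV[R]_n) c :
  'D_v (fun y : 'rV[R]_n => y 0 c) x = v 0 c.
Proof.
have := derive_mx (@derivable_id R 'rV[R]_n x v).
by rewrite derive_id => /matrixP/(_ 0 c); rewrite mxE.
Qed.

(** The partial derivatives of a coordinate are constant, so a case split on the order replaces an
    induction. *)
Lemma smooth_coord O c : smooth O (fun x : 'rV[R]_n => x 0 c).
Proof.
case=> [|k]; first by split=> // x _; exact: coord_continuous.
split=> [x _|i]; first exact: coord_continuous.
split=> [x _|]; first by apply: diff_derivable; exact: differentiable_coord.
have -> : 'D_(delta_mx 0 i) (fun x : 'rV[R]_n => x 0 c) =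
    (fun=> delta_mx (0 : 'I_1) i 0 c) by apply/funext => x; exact: derive_coord.
exact: Ck_cst.
Qed.

Definition euclid_chart : chart R n 'rV[R]_n :=
  @Chart R n 'rV[R]_n setT setT id id openT openT (fun _ _ => I) (fun _ _ => I)
    (fun _ _ => erefl) (fun _ _ => erefl)
    (fun _ _ => cvg_id) (fun _ _ => cvg_id).

Definition euclid : manifold R :=
  @Manifold R 'rV[R]_n n unit (fun=> euclid_chart) (@norm_hausdorff _ _)
    rV_second_countable (fun p => ex_intro _ tt I)
    (fun _ _ c => smooth_coord _ c).

Lemma smooth_on_euclid (f : 'rV[R]_n -> R) :
  smooth setT f -> @smooth_on R euclid setT f.
Proof. by move=> sf i k; apply: sub_Ck (sf k). Qed.

Lemma Cinf_euclid_smooth (f : Cinf euclid) : smooth setT (f : 'rV[R]_n -> R).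
Proof. by move=> k; apply: sub_Ck (Cfun_smooth f tt k). Qed.

Definition coord_fun (c : 'I_n) : Cinf euclid :=
  MkCinf (smooth_on_euclid (@smooth_coord setT c)).

Lemma partial_smooth (i : 'I_n) (f : Cinf euclid) :
  @smooth_on R euclid setT ('D_(delta_mx 0 i) (f : 'rV[R]_n -> R)).
Proof.
apply: smooth_on_euclid => k.
by have [_ /(_ i)[]] := Cinf_euclid_smooth f k.+1.
Qed.

Lemma Cinf_derivable (i : 'I_n) (f : Cinf euclid) (x : 'rV[R]_n) :
  derivable (f : 'rV[R]_n -> R) x (delta_mx 0 i).
Proof. by have [_ /(_ i)[+ _]] := Cinf_euclid_smooth f 1; apply. Qed.

Definition partial_fun i f : Cinf euclid := MkCinf (partial_smooth i f).

Fact partial_linear i c (f g : Cinf euclid) :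
  partial_fun i (Cinf_cst c * f + g) =
  Cinf_cst c * partial_fun i f + partial_fun i g.
Proof.
apply: Cinf_ext => x; rewrite CinfDE CinfME /=.
have df := @Cinf_derivable i f x; have dg := @Cinf_derivable i g x.
rewrite -[LHS]/('D_(delta_mx 0 i) (c *: (f : 'rV[R]_n -> R) + g) x).
rewrite deriveD //; last exact: derivableZ.
by rewrite deriveZ.
Qed.

Fact partial_leibniz i (f g : Cinf euclid) :
  partial_fun i (f * g) = partial_fun i f * g + f * partial_fun i g.
Proof.
apply: Cinf_ext => x; rewrite CinfDE !CinfME /=.
have df := @Cinf_derivable i f x; have dg := @Cinf_derivable i g x.
rewrite -[LHS]/('D_(delta_mx 0 i) ((f : 'rV[R]_n -> R) * g) x) deriveM //.
by rewrite addrC; congr (_ + _); rewrite mulrC.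
Qed.

Definition partial (i : 'I_n) : vfield euclid :=
  MkVfield (partial_linear i) (partial_leibniz i).

Definition dcoord (c : 'I_n) : form euclid 1 := ext_d (form0 (coord_fun c)).

Lemma dcoord_partial c i : dcoord c (fun=> partial i) = (i == c)%:R.
Proof.
rewrite /dcoord ext_d_form0; apply: Cinf_ext => x.
rewrite -[LHS]/('D_(delta_mx 0 i) (fun y : 'rV[R]_n => y 0 c) x).
by rewrite derive_coord mxE eqxx /= eq_sym; case: eqP.
Qed.

End EuclideanSpace.
Arguments euclid : clear implicits.

(** * Trivial bundles, with constant endomorphisms and constant sections *)

Section TrivialBundle.
Context {R : realType} (M : manifold R) (r : nat).

Fact triv_transition (i j : unit) : exists g : M -> 'M[R]_r,
  (forall a b, smooth_on (setT `&` setT) (fun p => g p a b)) /\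
  (forall (p : M) (v : 'rV[R]_r), (setT `&` setT) p -> v = v *m g p).
Proof.
exists (fun=> 1%:M); split=> [a b|p v _]; first exact: smooth_on_cst.
by rewrite mulmx1.
Qed.

Definition triv_bundle : vbundle M :=
  @VBundle R M (fun=> 'rV[R]_r) r unit (fun=> setT) (fun _ _ => idfun)
    (fun=> openT) (fun p => ex_intro _ tt I)
    (fun _ _ _ => Bijective (fun=> erefl) (fun=> erefl)) triv_transition.

Fact bhom_mx_smooth (A : 'M[R]_r) (j : unit) : exists g : M -> 'M[R]_r,
  (forall a b, smooth_on setT (fun p => g p a b)) /\
  (forall (p : M) (v : 'rV[R]_r), setT p -> v *m A = v *m g p).
Proof. by exists (fun=> A); split=> // a b; exact: smooth_on_cst. Qed.

(** Fibres consist of row vectors, so acting by [A] and then by [B] is multiplication by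
    [A *m B]. *)
Definition bhom_mx (A : 'M[R]_r) : bhom triv_bundle :=
  @MkBHom R M triv_bundle (fun p => mulmxr A) (bhom_mx_smooth A).

Fact section_cst_smooth (v : 'rV[R]_r) (j : vindex triv_bundle) c :
  smooth_on (vdom j) (@vcoord R M triv_bundle (fun=> v) j c).
Proof. exact: smooth_on_cst. Qed.

Definition section_cst v : section triv_bundle :=
  MkSection (section_cst_smooth v).

End TrivialBundle.

(** * Explicit wedge products in total degree one and two *)

Section WedgeLowDegree.
Context {R : realType} {M : manifold R}.

Lemma wedge01 (e : (0 + 1)%N = 1%N) (a : form M 0) (b : form M 1) :
  wedge e a b = form0_val a *: b.
Proof.
apply: form_ext => X; rewrite formZE /= /wedge_fun (bigD1 1%g) //=.
rewrite big1 ?addr0 => [|s /eqP[]]; last by apply/permP => i; rewrite !ord1.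
rewrite odd_perm1 mul1r (_ : Cinf_cst _ = 1) ?mul1r.
  by congr (a _ * b _); apply/funext => i; [case: i|rewrite !ord1].
by apply: Cinf_ext => x /=; rewrite invr1.
Qed.

Lemma perm2_eq (s t : 'S_2) : s 0 = t 0 -> s = t.
Proof.
have [u ->] := perm_lift_perm s 0; have [v ->] := perm_lift_perm t 0.
by rewrite !lift_perm_id => ->; congr lift_perm; apply/permP => i;
  rewrite !ord1.
Qed.

Lemma wedge11 (e : (1 + 1)%N = 2%N) (a b : form M 1) (X : 'I_2 -> vfield M) :
  wedge e a b X =
  a (fun=> X 0) * b (fun=> X 1) - a (fun=> X 1) * b (fun=> X 0).
Proof.
have c0 : cast_ord e (lshift 1 0) = 0 by exact: val_inj.
have c1 : cast_ord e (rshift 1 0) = 1 by exact: val_inj.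
have E (s : 'S_2) : a (fun i => X (s (cast_ord e (lshift 1 i)))) *
    b (fun j => X (s (cast_ord e (rshift 1 j)))) =
    a (fun=> X (s 0)) * b (fun=> X (s 1)).
  by congr (a _ * b _); apply/funext => i; rewrite ord1 ?c0 ?c1.
(* Split off the identity and the transposition; by [perm2_eq] the rest of the sum over ['S_2] is
   empty. *)
rewrite /= /wedge_fun (bigD1 1%g) //= (bigD1 (tperm 0 1)) /=; last first.
  by apply/eqP => /permP/(_ 0); rewrite tpermL perm1.
rewrite big1 ?addr0 => [|s /andP[/eqP s1 /eqP st]]; last first.
  case: (unliftP 0 (s 0)) => [j|] sj; last first.
    by case: s1; apply: perm2_eq; rewrite perm1.
  by case: st; apply: perm2_eq; rewrite tpermL sj ord1; exact: val_inj.
rewrite !E odd_perm1 odd_tperm !perm1 tpermL tpermR mul1r mulN1r.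
rewrite (_ : Cinf_cst _ = 1) ?mul1r //.
by apply: Cinf_ext => x /=; rewrite invr1.
Qed.

End WedgeLowDegree.

(** Every tensor is a finite sum of pure ones, so identities between additive maps need checking
    only on generators. *)
Lemma tens_ind (A : comPzRingType) (U V : lmodType A) (Q : tensor U V -> Prop) :
  Q 0 -> (forall u v x, Q x -> Q (tens u v + x)) -> forall x, Q x.
Proof.
move=> Q0 QD x; rewrite [x]tensE.
elim: (generic_quotient.repr x) => [|[u v] s IH]; first by rewrite big_nil.
by rewrite big_cons; exact: QD.
Qed.

(** * Linearity of the wedge product with bundle-valued forms *)

Section TensorWedge.
Context {R : realType} {M : manifold R} {xi : vbundle M}.
Context {k l m : nat} (e : (k + l)%N = m).
Implicit Types (a b : form M k) (x : tform xi l) (f : Cinf M).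

Lemma twedge0 a : twedge e a (0 : tform xi l) = 0.
Proof. by apply: (addrI (twedge e a 0)); rewrite -twedgeD !addr0. Qed.

Lemma twedgeZr f a x : twedge e a (f *: x) = f *: twedge e a x.
Proof.
elim/tens_ind: x => [|w s x IH]; first by rewrite scaler0 twedge0 scaler0.
by rewrite scalerDr !twedgeD IH scalerDr -tensZl !twedgeE wedgeZr tensZl.
Qed.

Lemma twedge_lin f a b x :
  twedge e (f *: a + b) x = f *: twedge e a x + twedge e b x.
Proof.
elim/tens_ind: x => [|w s x IH]; first by rewrite !twedge0 scaler0 addr0.
by rewrite !twedgeD IH !twedgeE wedgeDl tensDl tensZl scalerDr addrACA.
Qed.

Lemma twedgeZl f a x : twedge e (f *: a) x = f *: twedge e a x.
Proof.
have w0 : twedge e 0 x = 0.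
  apply: (addrI (twedge e 0 x)); rewrite addr0.
  by rewrite -[X in X + _]scale1r -twedge_lin scale1r addr0.
by rewrite -[f *: a]addr0 twedge_lin w0 addr0.
Qed.

Lemma twedgeDl a b x : twedge e (a + b) x = twedge e a x + twedge e b x.
Proof. by rewrite -[a]scale1r twedge_lin !scale1r. Qed.

End TensorWedge.

Lemma twedge01 (R : realType) (M : manifold R) (xi : vbundle M)
    (e : (0 + 1)%N = 1%N) (a : form M 0) (x : tform xi 1) :
  twedge e a x = form0_val a *: x.
Proof.
elim/tens_ind: x => [|w s x IH]; first by rewrite twedge0 scaler0.
by rewrite twedgeD IH twedgeE wedge01 tensZl scalerDr.
Qed.

(** * Pseudoconnections whose principal homomorphism acts as zero *)

Section ZeroPrincipal.
Context {R : realType} {M : manifold R} {xi : vbundle M} (P : bhom xi).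
Context (P0 : forall s, bhom_section P s = 0) (L : section xi -> tform xi 1)
  (L_linear : forall (f : Cinf M) s t, L (f *: s + t) = f *: L s + L t).

Let LD s t : L (s + t) = L s + L t.
Proof. by rewrite -[s]scale1r L_linear !scale1r. Qed.
Let L0 : L 0 = 0.
Proof. by apply: (addrI (L 0)); rewrite -LD !addr0. Qed.
Let LZ f s : L (f *: s) = f *: L s.
Proof. by rewrite -[f *: s]addr0 L_linear L0 addr0. Qed.

Fact zero_principal_leibniz (f : Cinf M) (s : section xi) :
  L (f *: s) =
    (btens (ext_d (form0 f)) (bhom_section P s) : tform xi 1) + f *: L s.
Proof. by rewrite P0 /= tens0r add0r LZ. Qed.

Definition zero_pconn : pseudoconnection P :=
  @MkPseudoconnection R M xi P L (fun c => L_linear (Cinf_cst c))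
    zero_principal_leibniz.

Definition zero_extd_tform k (x : tform xi k) : tform xi k.+1 :=
  tens_lift (fun w s => (-1) ^+ k *: twedge (addn1 k) w (L s)) x.

Definition zero_extd (k : nat) : bform xi k -> bform xi k.+1 :=
  match k return bform xi k -> bform xi k.+1 with
  | 0 => L
  | k'.+1 => @zero_extd_tform k'.+1
  end.

(** The term with [ext_d w] is absent because [P] kills sections. What remains is balanced over the
    smooth functions, since [L] is linear over them, and so it descends to the tensor product. *)
Lemma zero_extd_tformE k (w : form M k) (s : section xi) :
  zero_extd_tform (tens w s) = (-1) ^+ k *: twedge (addn1 k) w (L s).
Proof.
apply: tens_liftE => [u u' v|u v v'|a u v].
- by rewrite twedgeDl scalerDr.
- by rewrite LD twedgeD scalerDr.
- by rewrite LZ twedgeZr twedgeZl.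
Qed.

Lemma zero_extd_tformD k (x y : tform xi k) :
  zero_extd_tform (x + y) = zero_extd_tform x + zero_extd_tform y.
Proof.
apply: tens_liftD => [u u' v|u v v'|a u v].
- by rewrite twedgeDl scalerDr.
- by rewrite LD twedgeD scalerDr.
- by rewrite LZ twedgeZr twedgeZl.
Qed.

Lemma zero_extd_tform0 k : zero_extd_tform (0 : tform xi k) = 0.
Proof.
by apply: (addrI (zero_extd_tform 0)); rewrite -zero_extd_tformD !addr0.
Qed.

Lemma zero_extd_tformZ k f (x : tform xi k) :
  zero_extd_tform (f *: x) = f *: zero_extd_tform x.
Proof.
elim/tens_ind: x => [|w s x IH].
  by rewrite scaler0 zero_extd_tform0 scaler0.
rewrite scalerDr !zero_extd_tformD IH scalerDr -tensZl.
rewrite !zero_extd_tformE twedgeZl.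
by rewrite !scalerA mulrC.
Qed.

Lemma zero_extdP : is_ext_derivative zero_pconn zero_extd.
Proof.
split=> [//|[|k] c x y|[|k] w s] /=.
- exact: L_linear.
- by rewrite zero_extd_tformD zero_extd_tformZ.
(* In degree 0 the generator is the section [form0_val w *: s], and the rule says that [L] commutes
   with this scaling. *)
- by rewrite P0 tens0r add0r scale1r twedge01 LZ.
- by rewrite P0 tens0r add0r zero_extd_tformE.
Qed.

Lemma zero_Fcurv s : Fcurv zero_pconn zero_extd s = 0.
Proof.
(* [P] kills forms of every degree, as each summand becomes [tens w 0]; this removes the first two
   terms of [Fcurv], and [P0] the third. *)
have Pt k (x : tform xi k) : bhom_tform P x = 0.
  by rewrite /bhom_tform /tens_lift big1 // => z _; rewrite P0 tens0r.
by rewrite /Fcurv /= !Pt P0 L0 !zero_extd_tform0 subrr addr0.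
Qed.

End ZeroPrincipal.

(** * Constant coefficients over the plane *)

Section ConstantCoefficients.
Context {R : realType} {r : nat}.
Local Notation M := (euclid R 2).
Local Notation xi := (triv_bundle M r).
Implicit Types (w : form M 2) (s : section xi) (x : tform xi 2).

(** Value of a bundle-valued 2-form on the coordinate frame at the origin. This additive map
    certifies that a tensor is nonzero without inspecting the quotient. *)
Definition frame_eval x : 'rV[R]_r :=
  tens_lift (fun w s => w (fun i => partial i) 0 *: (s 0 : 'rV[R]_r)) x.

Lemma frame_evalE w s :
  frame_eval (tens w s) = w (fun i => partial i) 0 *: (s 0 : 'rV[R]_r).
Proof.
apply: tens_liftE => [u u' v|u v v'|a u v].
- by rewrite formDE CinfDE scalerDl.
- by rewrite scalerDr.
- by rewrite formZE CinfME scalerA mulrC.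
Qed.

Lemma frame_evalD x y : frame_eval (x + y) = frame_eval x + frame_eval y.
Proof.
apply: tens_liftD => [u u' v|u v v'|a u v].
- by rewrite formDE CinfDE scalerDl.
- by rewrite scalerDr.
- by rewrite formZE CinfME scalerA mulrC.
Qed.

Lemma frame_eval0 : frame_eval 0 = 0.
Proof. by rewrite -[0](tens0l 0) frame_evalE scale0r. Qed.

Lemma frame_evalN x : frame_eval (- x) = - frame_eval x.
Proof. by apply/eqP; rewrite -addr_eq0 -frame_evalD addNr frame_eval0. Qed.

(** The scalar is the 2 by 2 determinant of the two coordinate one-forms on the frame, to which they
    are dual. *)
Lemma frame_eval_wedge e i j s :
  frame_eval (tens (wedge e (dcoord i) (dcoord j)) s) =
  ((i == 0)%:R * (j == 1)%:R - (i == 1)%:R * (j == 0)%:R) *: (s 0 : 'rV[R]_r).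
Proof.
have natE (b : bool) : (b%:R : Cinf M) 0 = b%:R by case: b.
rewrite frame_evalE wedge11 !dcoord_partial CinfDE CinfNE !CinfME !natE.
by rewrite ![_ == 0]eq_sym ![_ == 1]eq_sym.
Qed.

Definition mx_conn (A B : 'M[R]_r) s : tform xi 1 :=
  tens (dcoord 0) (bhom_section (bhom_mx M A) s) +
  tens (dcoord 1) (bhom_section (bhom_mx M B) s).

Lemma mx_conn_linear A B (f : Cinf M) s t :
  mx_conn A B (f *: s + t) = f *: mx_conn A B s + mx_conn A B t.
Proof.
by rewrite /mx_conn !bhom_section_linear !tensDr !tensZr scalerDr addrACA.
Qed.

Lemma frame_eval_curvature A B s :
  frame_eval (zero_extd_tform (mx_conn A B) (mx_conn A B s)) =
  (s 0 : 'rV[R]_r) *m (B *m A - A *m B).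
Proof.
have lin := mx_conn_linear A B.
(* With the sign [(-1) ^+ 1], the mixed terms are - dx /\ dy (x) s A B and - dy /\ dx (x) s B A; the
   terms in dx /\ dx and dy /\ dy vanish. *)
rewrite {2}/mx_conn (zero_extd_tformD lin) !(zero_extd_tformE lin) /mx_conn.
rewrite !twedgeD !twedgeE !expr1 !scaleN1r !(frame_evalD, frame_evalN).
rewrite !frame_eval_wedge !eqxx /= !(mulr0, mul0r, mulr1, subrr, subr0, sub0r).
rewrite !(oppr0, scale0r, scaleN1r, scale1r, addr0, add0r, opprK).
by rewrite mulmxBr !mulmxA addrC.
Qed.

End ConstantCoefficients.

(** * The counterexample from two noncommuting elementary matrices *)

Theorem proposition2p8 (R : realType) :
  exists (M : manifold R) (xi : vbundle M) (P : bhom xi)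
         (nabla : pseudoconnection P)
         (D : forall k : nat, bform xi k -> bform xi k.+1),
    is_ext_derivative nabla D /\
    (forall s : section xi, Fcurv nabla D s = 0) /\
    ~ is_chain_complex D.
Proof.
pose M := euclid R 2.
pose A : 'M[R]_2 := delta_mx 0 1; pose B : 'M[R]_2 := delta_mx 1 0.
have P0 s : bhom_section (bhom_mx M (0 : 'M[R]_2)) s = 0.
  by apply: section_ext => p; exact: mulmx0.
have lin := mx_conn_linear A B.
exists M, (triv_bundle M 2), (bhom_mx M 0).
exists (zero_pconn P0 lin), (zero_extd (mx_conn A B)).
split; first exact: zero_extdP.
split; first exact: zero_Fcurv.
(* Already in degree 0 the composite is nonzero on the constant first basis row e_0: e_0 B = 0 and
   e_0 A B = e_0, so the value is - e_0, whose entry at [0 0] is -1. *)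
move=> /(_ 0%N (section_cst M (delta_mx 0 0))) /(congr1 frame_eval).
rewrite frame_eval0 frame_eval_curvature mulmxBr !mulmxA !mul_delta_mx_cond /=.
move/matrixP/(_ 0 0)/eqP; rewrite !mxE /= big1 => [|j _].
  by rewrite sub0r oppr_eq0 oner_eq0.
by rewrite mulr0n mxE mul0r.
Qed.
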